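(* Let $n\ge1$ and $k\in\{1,2,3\}$. The function $\mathrm{Inv}: B_B(J_n,k)\to 2^{C_B(J_n,k+1)}$ is injective.
   Context: **Sets.** For $n\ge 1$ let $J_n=\{-n,\dots,-1,1,\dots,n\}$. For a finite set $E\subset\mathbb Z\setminus\{0\}$ with $E=-E$, let $E_+$ be its set of positive elements. Put $C_B(E,1)=E$. For $k>1$: $C_B^1(E,k)$ is the set of $k$-element subsets of $E$ whose elements have pairwise distinct absolute values, modulo the identification $S\sim -S$; the class of $\{a_1,\dots,a_k\}$ is written $[a_1,\dots,a_k]$. $C_B^2(E,k)=\{T\cup\{\star\}: T\subset E_+,\ |T|=k-1\}$, where $\star$ is a formal symbol; such an element is written $[b_1,\dots,b_{k-1},\star]$ or equivalently $[-b_1,\dots,-b_{k-1},\star]$. Put $C_B(E,k)=C_B^1(E,k)\cup C_B^2(E,k)$. **Packets.** To $K\in C_B(J_n,k+1)$ is attached its packet $P_B(K)\subset C_B(J_n,k)$ (a ''$k$-packet''): if $K=[a,b]\in C_B^1(J_n,2)$ then $P_B(K)=\{a,-a,b,-b\}$; if $K=[a_1,\dots,a_{k+1}]\in C_B^1(J_n,k+1)$ with $k>1$ then $P_B(K)$ is the set of classes of the $k$-element subsets of $\{a_1,\dots,a_{k+1}\}$; if $K\in C_B^2(J_n,k+1)$ and $K'=K\setminus\{\star\}$ then $P_B(K)=C_B(K'\cup(-K'),k)$. **Preferred representatives.** For an element of $C_B^1(J_n,k)$, the preferred representative is the one whose element of greatest absolute value is negative. It is listed with negative elements first, in increasing order,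 followed by positive elements in decreasing order. **Standard orders** (all with respect to preferred representatives). - $C_B(J_n,1)=J_n$: the usual order of integers. - $C_B(J_n,2)$: represent $[a,\star]$ ($a>0$) by $[-a,a]$ and list elements as $[a_1,a_2]$ with $a_1<a_2$. Elements with two negative indices come first (are smallest), in lexicographic order; then come the elements with exactly one negative index, ordered by $[a_1,a_2]<[b_1,b_2]$ if $a_1<b_1$, or $a_1=b_1$ and $a_2>b_2$. - $C_B(J_n,3)$: represent $[a_1,a_2,\star]$ ($a_1>a_2>0$) by $[-a_1,-a_2,a_2]$. Elements with three negative indices come first, in lexicographic order. Elements with exactly two negative indices come second, ordered by $[a_1,a_2,a_3]<[b_1,b_2,b_3]$ (where $a_1<a_2<0<a_3$, $b_1<b_2<0<b_3$) if $[a_1,a_2]<[b_1,b_2]$ in the standard order of $C_B(J_n,2)$, or $[a_1,a_2]=[b_1,b_2]$ and $a_3>b_3$. Elements with exactly one negative index come third, ordered by $[a_1,a_2,a_3]<[b_1,b_2,b_3]$ (where $a_1<0<a_3<a_2$, $b_1<0<b_3<b_2$) if $a_1>b_1$, or $a_1=b_1$ and $[-a_2,-a_3]<[-b_2,-b_3]$ in the standard order of $C_B(J_n,2)$. The standard order is denoted $\rho_{min}$. **Packet orders.** For a $k$-packet $P_B(K)$ with $k\in\{2,3\}$, the standard packet order is the restriction of $\rho_{min}$ on $C_B(J_n,k)$. For $k=1$ the packet order is a partial order depending on $K$: if $K=[j,i]\in C_B^1(J_n,2)$ with $\{j,i\}$ preferred ($j<0$, $|j|>|i|$), the relations are $j<i$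 and $-i<-j$ only; if $K=[k,\star]$ with $k>0$, the relation is $-k<k$. $\mathrm{Rev}\,P_B(K)$ denotes the packet with the opposite order. **Admissible orders and $B_B$** (for $k\le 3$). A total order $\rho$ of $C_B(J_n,k)$ is admissible if for every $K\in C_B(J_n,k+1)$ it extends the standard order of $P_B(K)$ or that of $\mathrm{Rev}\,P_B(K)$. $A_B(J_n,k)$ is the set of admissible orders. $\mathrm{Inv}(\rho)$ is the set of $K\in C_B(J_n,k+1)$ such that $\rho$ extends $\mathrm{Rev}\,P_B(K)$. Two elements of $C_B(J_n,k)$ commute if they are incomparable in the packet order of every $k$-packet $P_B(K)$ containing both. Two admissible orders are elementarily equivalent if one is obtained from the other by exchanging two adjacent commuting elements; $\sim$ is the equivalence relation generated by this, $B_B(J_n,k)=A_B(J_n,k)/\sim$, and $[\rho]$ is the class of $\rho$. $\mathrm{Inv}$ is constant on classes, so it descends to $B_B(J_n,k)$ via $\mathrm{Inv}([\rho])=\mathrm{Inv}(\rho)$. *)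

(* Defs.v *)
From HB Require Import structures.
From mathcomp Require Import all_boot all_order all_algebra.
From mathcomp Require Import finmap.

Set Implicit Arguments.
Unset Strict Implicit.
Unset Printing Implicit Defensive.

Import Order.TTheory GRing.Theory Num.Theory.
Local Open Scope ring_scope.
Local Open Scope fset_scope.

Definition J (n : nat) : {fset int} :=
  [fset i%:Z | i in iota 1 n] `|` [fset - i%:Z | i in iota 1 n].

Definition negs (S : {fset int}) : {fset int} := [fset - x | x in S].

Definition posit (E : {fset int}) : {fset int} := [fset x in E | 0 < x].

(* [Class c] carries an equivalence class c = {S, -S}, as a set of sets;
   [Starred T] stands for T together with the formal symbol "star". *)
Inductive cbelt : Type :=
  | Index of int
  | Class of {fset {fset int}}
  | Starred of {fset int}.

Definition cbelt_code (x : cbelt) : int + {fset {fset int}} + {fset int} :=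
  match x with
  | Index a => inl (inl a)
  | Class c => inl (inr c)
  | Starred T => inr T
  end.

Definition cbelt_decode (u : int + {fset {fset int}} + {fset int}) : cbelt :=
  match u with
  | inl (inl a) => Index a
  | inl (inr c) => Class c
  | inr T => Starred T
  end.

Lemma cbelt_codeK : cancel cbelt_code cbelt_decode.
Proof. by case. Qed.

HB.instance Definition _ := Choice.copy cbelt (can_type cbelt_codeK).

Definition cls (S : {fset int}) : {fset {fset int}} := [fset S; negs S].

Definition abs_distinct (S : {fset int}) : bool :=
  [forall x : S, [forall y : S, (`|val x| == `|val y|) ==> (x == y)]].

Definition CB1 (E : {fset int}) (k : nat) : {fset cbelt} :=
  [fset Class (cls S) | S in [fset S in fpowerset E |
                               (#|` S| == k) && abs_distinct S]].

Definition CB2 (E : {fset int}) (k : nat) : {fset cbelt} :=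
  [fset Starred T | T in [fset T in fpowerset (posit E) | #|` T| == k.-1]].

(* k = 0 is given the junk value fset0. *)
Definition CB (E : {fset int}) (k : nat) : {fset cbelt} :=
  match k with
  | 0 => fset0
  | 1 => [fset Index a | a in E]
  | _ => CB1 E k `|` CB2 E k
  end.

Definition preferred (S : {fset int}) : bool :=
  [exists a : S, (val a < 0) && [forall b : S, `|val b| <= `|val a|]].

(* For c = {S, -S} with S nonempty, free of 0 and with pairwise distinct
   absolute values, exactly one of S and -S is preferred. *)
Definition prefrep (c : {fset {fset int}}) : {fset int} :=
  head fset0 [seq S <- c | preferred S].

Definition listing (S : {fset int}) : seq int :=
  sort <=%O [seq x <- S | x < 0] ++ sort >=%O [seq x <- S | 0 < x].

(* The k-packet of an element K of CB (J n) k.+1. *)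
Definition packet (k : nat) (K : cbelt) : {fset cbelt} :=
  match K with
  | Index _ => fset0
  | Class c =>
      let S := prefrep c in
      if k == 1%N then [fset Index a | a in S `|` negs S]
      else [fset Class (cls T) | T in [fset T in fpowerset S | #|` T| == k]]
  | Starred T => CB (T `|` negs T) k
  end.

(* The sequence [a_1, ..., a_k] by which an element is represented in the
   definition of the standard orders (k <= 3). *)
Definition indices (x : cbelt) : seq int :=
  match x with
  | Index a => [:: a]
  | Class c => listing (prefrep c)
  | Starred T =>
      match sort >=%O (T : seq int) with
      | [:: a] => [:: - a; a]
      | [:: a1; a2] => [:: - a1; - a2; a2]
      | _ => [::]
      end
  end.

Definition lex2 (a1 a2 b1 b2 : int) : bool :=
  (a1 < b1) || (a1 == b1) && (a2 < b2).

Definition lex3 (a1 a2 a3 b1 b2 b3 : int) : bool :=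
  (a1 < b1) || (a1 == b1) && lex2 a2 a3 b2 b3.

Definition nneg (s : seq int) : nat := count (fun a => a < 0) s.

Definition std2 (a1 a2 b1 b2 : int) : bool :=
  match nneg [:: a1; a2], nneg [:: b1; b2] with
  | 2, 2 => lex2 a1 a2 b1 b2
  | 2, 1 => true
  | 1, 1 => (a1 < b1) || (a1 == b1) && (b2 < a2)
  | _, _ => false
  end.

Definition std3 (a1 a2 a3 b1 b2 b3 : int) : bool :=
  match nneg [:: a1; a2; a3], nneg [:: b1; b2; b3] with
  | 3, 3 => lex3 a1 a2 a3 b1 b2 b3
  | 3, 2 | 3, 1 | 2, 1 => true
  | 2, 2 => std2 a1 a2 b1 b2 || [&& a1 == b1, a2 == b2 & b3 < a3]
  | 1, 1 => (b1 < a1) || (a1 == b1) && std2 (- a2) (- a3) (- b2) (- b3)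
  | _, _ => false
  end.

(* The standard order rho_min (as a strict order) on CB (J n) k, k = 1, 2, 3. *)
Definition rho_min (x y : cbelt) : bool :=
  match indices x, indices y with
  | [:: a], [:: b] => a < b
  | [:: a1; a2], [:: b1; b2] => std2 a1 a2 b1 b2
  | [:: a1; a2; a3], [:: b1; b2; b3] => std3 a1 a2 a3 b1 b2 b3
  | _, _ => false
  end.

(* The strict partial order carried by a 1-packet: for K = [j, i] the relations
   are j < i and -i < -j, for K = [a, star] the relation is -a < a. *)
Definition order1 (K x y : cbelt) : bool :=
  match K, indices K with
  | Class _, [:: j; i] =>
      (x == Index j) && (y == Index i) ||
      (x == Index (- i)) && (y == Index (- j))
  | Starred _, [:: a'; a] => (x == Index a') && (y == Index a)
  | _, _ => false
  end.

Definition packet_lt (k : nat) (K x y : cbelt) : bool :=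
  [&& x \in packet k K, y \in packet k K &
      if k == 1%N then order1 K x y else rho_min x y].

Definition rev_packet_lt (k : nat) (K x y : cbelt) : bool := packet_lt k K y x.

(* A strict order rho on the finite set CB (J n) k is represented by its graph,
   i.e., (x, y) \in rho means that x is strictly smaller than y. *)
Section Orders.
Variables n k : nat.
Implicit Types rho : {set CB (J n) k * CB (J n) k}.

Definition total_order rho : bool :=
  [&& [forall x, (x, x) \notin rho],
      [forall x, forall y, forall z,
         ((x, y) \in rho) && ((y, z) \in rho) ==> ((x, z) \in rho)] &
      [forall x, forall y, (x != y) ==> ((x, y) \in rho) || ((y, x) \in rho)]].

Definition extends rho (R : rel cbelt) : bool :=
  [forall x, forall y, R (val x) (val y) ==> ((x, y) \in rho)].

Definition admissible rho : bool :=
  total_order rho &&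
  [forall K : CB (J n) k.+1,
     extends rho (packet_lt k (val K)) || extends rho (rev_packet_lt k (val K))].

Definition AB := {rho | admissible rho}.

Definition Inv (r : AB) : {set CB (J n) k.+1} :=
  [set K | extends (val r) (rev_packet_lt k (val K))].

Definition commuting (x y : CB (J n) k) : bool :=
  [forall K : CB (J n) k.+1,
     (val x \in packet k (val K)) && (val y \in packet k (val K)) ==>
     ~~ packet_lt k (val K) (val x) (val y) &&
     ~~ packet_lt k (val K) (val y) (val x)].

Definition adjacent rho (x y : CB (J n) k) : bool :=
  ((x, y) \in rho) &&
  [forall z, ~~ (((x, z) \in rho) && ((z, y) \in rho))].

Definition exchange rho (x y : CB (J n) k) : {set CB (J n) k * CB (J n) k} :=
  (y, x) |: (rho :\ (x, y)).

Definition obtained_by_exchange (r s : AB) : bool :=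
  [exists x, exists y, [&& adjacent (val r) x y, commuting x y &
                           val s == exchange (val r) x y]].

Definition elem_equiv (r s : AB) : bool :=
  obtained_by_exchange r s || obtained_by_exchange s r.

Definition sim : rel AB := connect elem_equiv.

Lemma sim_refl : reflexive sim.
Proof. exact: connect0. Qed.

Lemma sim_sym : symmetric sim.
Proof. by apply: sym_connect_sym => r s; rewrite /elem_equiv orbC. Qed.

Lemma sim_trans : transitive sim.
Proof. exact: connect_trans. Qed.

Canonical sim_equiv := EquivRel sim sim_refl sim_sym sim_trans.

Definition BB := {eq_quot sim}%qT.

Local Lemma extends_exchange rho x y (K : CB (J n) k.+1) :
  commuting x y ->
  extends (exchange rho x y) (rev_packet_lt k (val K)) =
  extends rho (rev_packet_lt k (val K)).
Proof.
move=> /forallP/(_ K); rewrite /rev_packet_lt => cxy.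
apply: eq_forallb => u; apply: eq_forallb => v.
case Rvu: (packet_lt k (val K) (val v) (val u)) => //=.
have /and3P[vP uP _] := Rvu.
rewrite !inE !xpair_eqE.
case: (boolP ((u == y) && (v == x))) => [/andP[/eqP eu /eqP ev]|_] /=.
  by move: cxy; rewrite -eu -ev uP vP Rvu.
case: (boolP ((u == x) && (v == y))) => [/andP[/eqP eu /eqP ev]|_] //=.
by move: cxy; rewrite -eu -ev uP vP Rvu andbF.
Qed.

Lemma Inv_sim (r s : AB) : sim r s -> Inv r = Inv s.
Proof.
have ex (r' s' : AB) : obtained_by_exchange r' s' -> Inv r' = Inv s'.
  move=> /existsP[x /existsP[y /and3P[axy cxy /eqP es]]].
  by apply/setP => K; rewrite !inE es extends_exchange.
case/connectP => p; elim: p r => [r _ -> //|t p IHp r /= /andP[rt tp] es].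
by rewrite -(IHp t tp es); case/orP: rt => /ex.
Qed.

Definition InvB (c : BB) : {set CB (J n) k.+1} := Inv (generic_quotient.repr c).

Lemma InvB_pi (r : AB) : InvB (\pi_(BB) r)%qT = Inv r.
Proof.
apply/Inv_sim; apply/(eqmodP sim_equiv).
by rewrite generic_quotient.reprK.
Qed.

End Orders.

(* Main.v *)
(* Two admissible orders rho, sigma with the same inversion set agree on every
   pair that is comparable in some packet order.  If rho <> sigma, a pair
   x <_rho y with y <_sigma x that spans a shortest rho-interval is adjacent in
   rho, for an element in between would give a shorter such pair.  Hence x and y
   commute, and exchanging them in rho decreases the number of pairs on which
   rho and sigma disagree. *)
Require Import Defs.
From mathcomp Require Import all_boot all_order all_algebra.
From mathcomp Require Import finmap.

Section InvInjective.
Variables n k : nat.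
Implicit Types (rho sigma : {set CB (J n) k * CB (J n) k}) (r s : AB n k).

Lemma total_orderP rho :
  reflect [/\ forall x, (x, x) \notin rho,
              forall x y z, (x, y) \in rho -> (y, z) \in rho -> (x, z) \in rho &
              forall x y, x != y -> (x, y) \in rho \/ (y, x) \in rho]
          (total_order rho).
Proof.
apply: (iffP and3P) => -[irr tr tot]; split.
- exact/forallP.
- move=> x y z xy yz.
  by move/forallP/(_ x)/forallP/(_ y)/forallP/(_ z): tr; rewrite xy yz.
- by move=> x y /(implyP (forallP (forallP tot x) y))/orP.
- exact/forallP.
- apply/forallP => x; apply/forallP => y; apply/forallP => z.
  by apply/implyP => /andP[]; apply: tr.
- by apply/forallP => x; apply/forallP => y; apply/implyP => /tot/orP.
Qed.

(** Totality makes [rho] maximal: a pair of [sigma] missing from [rho] is reversed in [rho], hence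
    also in [sigma], and transitivity then gives a loop. *)
Lemma total_order_sub_eq rho sigma :
  total_order rho -> total_order sigma -> rho \subset sigma -> rho = sigma.
Proof.
move=> /total_orderP[_ _ tot] /total_orderP[irr tr _] sub.
apply/eqP; rewrite eqEsubset sub /=; apply/subsetP => -[x y] xy.
have neq : x != y by apply: contraTneq xy => ->; apply: irr.
case: (tot x y neq) => // /(subsetP sub) yx.
by have := irr x; rewrite (tr _ _ _ xy yx).
Qed.

Lemma adjacent_disagreement rho sigma :
  total_order rho -> total_order sigma -> rho != sigma ->
  exists x y, adjacent rho x y /\ (x, y) \notin sigma.
Proof.
move=> orho osigma neq.
have /subsetPn[p0 p0rho p0sigma] : ~~ (rho \subset sigma).
  by apply: contraNN neq => /(total_order_sub_eq _ _ orho osigma)->.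
have p0P : (p0 \notin sigma) && (p0 \in rho) by rewrite p0sigma.
pose gap x y := [set z | ((x, z) \in rho) && ((z, y) \in rho)].
case: (@arg_minnP _ _ (fun p => (p \notin sigma) && (p \in rho))
          (fun p => #|gap p.1 p.2|) p0P) => -[x y].
move=> /andP[xysigma xyrho] min_xy.
exists x, y; split => //; rewrite /adjacent xyrho /=.
apply/forallP => z; apply/negP => /andP[xz zy].
move: orho osigma => /total_orderP[irr tr _] /total_orderP[_ trs _].
(* One of [(x, z)], [(z, y)] is missing from [sigma], since otherwise transitivity would put
   [(x, y)] there. The gap of that pair is contained in [gap x y] and omits [z], against
   minimality. *)
case: (boolP ((x, z) \in sigma)) => [xzs|xzs].
- have zys : (z, y) \notin sigma by apply: contraNN xysigma; apply: trs.
  have := min_xy (z, y); rewrite zys zy => /(_ isT).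
  rewrite leqNgt => /negP; apply; apply/proper_card/properP; split.
    by apply/subsetP => t; rewrite !inE => /andP[zt ->]; rewrite (tr _ z).
  by exists z; rewrite !inE ?xz ?zy // negb_and irr.
- have := min_xy (x, z); rewrite xzs xz => /(_ isT).
  rewrite leqNgt => /negP; apply; apply/proper_card/properP; split.
    by apply/subsetP => t; rewrite !inE => /andP[-> tz]; rewrite (tr _ z).
  by exists z; rewrite !inE ?xz ?zy // negb_and irr orbT.
Qed.

(** The delicate point is transitivity. By adjacency and totality, whatever lies above [x], except
    [y], lies above [y], and whatever lies below [y], except [x], lies below [x]; so the reversed
    pair composes with the remaining ones. *)
Lemma total_order_exchange rho x y :
  total_order rho -> adjacent rho x y -> total_order (exchange rho x y).
Proof.
move=> /total_orderP[irr tr tot] /andP[xy /forallP nobetween].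
have neq : x != y by apply: contraTneq xy => ->; apply: irr.
have between z : (x, z) \in rho -> (z, y) \in rho -> False.
  by move=> xz zy; have := nobetween z; rewrite xz zy.
have inP u v : (u, v) \in exchange rho x y <->
    (u = y /\ v = x) \/ ((u, v) \in rho /\ ~ (u = x /\ v = y)).
  rewrite !inE !xpair_eqE; split.
    case/orP => [/andP[/eqP-> /eqP->]|/andP[/negP nxy uv]]; [by left|right].
    by split => // -[ux vy]; apply: nxy; rewrite ux vy !eqxx.
  case=> [[-> ->]|[-> nxy]]; first by rewrite !eqxx.
  rewrite andbT; apply/orP; right.
  by apply/negP => /andP[/eqP ux /eqP vy]; apply: nxy.
apply/total_orderP; split.
- move=> u; apply/negP => /inP[[uy ux]|[uu _]].
    by move: neq; rewrite -ux -uy eqxx.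
  by have := irr u; rewrite uu.
- move=> u v w /inP[[-> ->]|[uv nuv]] /inP[[vy wx]|[vw nvw]]; apply/inP.
  + by rewrite vy eqxx in neq.
  + right; have nwy : y != w by apply/eqP => yw; apply: nvw.
    split; last by case=> yx _; rewrite yx eqxx in neq.
    by case: (tot y w nwy) => // /(between _ vw).
  + subst v w; right; have nux : u != x by apply/eqP => ux; apply: nuv.
    split; last by case=> _ xy'; rewrite xy' eqxx in neq.
    by case: (tot u x nux) => // xu; case: (between u xu uv).
  (* Two old pairs compose to an old pair, and this is the deleted [(x, y)] only if [v] lies
     strictly between [x] and [y]. *)
  + right; split; first exact: tr uv vw.
    by case=> ux wy; subst u w; apply: between uv vw.
- have rho_or u v : (u, v) \in rho ->
      (u, v) \in exchange rho x y \/ (v, u) \in exchange rho x y.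
    move=> uv; have [[-> ->]|nuv] := (u, v) =P (x, y).
      by right; apply/inP; left.
    by left; apply/inP; right; split => // -[ux vy]; apply: nuv; rewrite ux vy.
  by move=> u v /tot[] /rho_or[]; by [left | right].
Qed.

Lemma commuting_incomparable (x y : CB (J n) k) (K : CB (J n) k.+1) :
  commuting x y ->
  ~~ packet_lt k (val K) (val x) (val y) /\
  ~~ packet_lt k (val K) (val y) (val x).
Proof.
move=> /forallP/(_ K) cxy.
by split; apply/negP => lt_xy; have /and3P[uP vP _] := lt_xy;
  move: cxy; rewrite uP vP lt_xy ?andbF.
Qed.

(** The exchange deletes only [(x, y)]. The relation [R] is kept general to cover both a packet
    order and its reverse. *)
Lemma extends_exchange rho (R : rel cbelt) x y :
  ~~ R (val x) (val y) -> extends rho R -> extends (exchange rho x y) R.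
Proof.
move=> nRxy /forallP ext.
apply/forallP => u; apply/forallP => v; apply/implyP => Ruv.
have uvrho := implyP (forallP (ext u) v) Ruv.
rewrite !inE uvrho andbT; apply/orP; right.
by apply: contraTneq Ruv => -[-> ->].
Qed.

Lemma admissible_exchange rho x y :
  admissible rho -> adjacent rho x y -> commuting x y ->
  admissible (exchange rho x y).
Proof.
move=> /andP[orho /forallP adm] axy cxy.
rewrite /admissible total_order_exchange //=; apply/forallP => K.
have [nxy nyx] := commuting_incomparable _ _ K cxy.
by case/orP: (adm K) => /extends_exchange ext; rewrite ext ?orbT.
Qed.

(** If [K] is a common inversion, both orders extend the reversed packet order; otherwise
    admissibility makes both extend the standard one. Either way the packet dictates the same
    direction to both. *)
Lemma eq_Inv_comparable r s (K : CB (J n) k.+1) x y :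
  Inv r = Inv s ->
  packet_lt k (val K) (val x) (val y) || packet_lt k (val K) (val y) (val x) ->
  (x, y) \in val r -> (x, y) \in val s.
Proof.
move=> /setP/(_ K); rewrite !inE.
case: r s => [rho /= /andP[/total_orderP[irr tr _] /forallP/(_ K) adr]].
case=> [sigma /= /andP[_ /forallP/(_ K) ads]] eqI cmp xy.
have nyx : (y, x) \notin rho.
  by apply/negP => yx; have := irr x; rewrite (tr _ _ _ xy yx).
move: adr ads; rewrite -eqI.
case: (boolP (extends rho (rev_packet_lt k (val K)))) eqI => /= er eqI.
- move=> _ _; case/orP: cmp => cmp.
    by have := implyP (forallP (forallP er y) x) cmp; rewrite (negPf nyx).
  by have /forallP/(_ x)/forallP/(_ y)/implyP := esym eqI; apply.
- rewrite !orbF => er' es'; case/orP: cmp => cmp.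
    exact: implyP (forallP (forallP es' x) y) cmp.
  by have := implyP (forallP (forallP er' y) x) cmp; rewrite (negPf nyx).
Qed.

Lemma eq_Inv_commuting r s x y :
  Inv r = Inv s -> (x, y) \in val r -> (x, y) \notin val s -> commuting x y.
Proof.
move=> eqI xyr xys; apply/forallP => K; apply/implyP => _.
rewrite -negb_or; apply: contraNN xys.
by move=> /(eq_Inv_comparable _ _ _ _ _ eqI)->.
Qed.

Lemma eq_Inv_sim r s : Inv r = Inv s -> sim r s.
Proof.
(* Induction on the number of pairs of [r] that [s] reverses. *)
have [m] := ubnP #|val r :\: val s|; elim: m r => // m IHm r le_m eqI.
have [/val_inj-> | neq] := eqVneq (val r) (val s); first exact: sim_refl.
have /andP[ors _] := valP r; have /andP[oss _] := valP s.
have [x [y [axy xys]]] := adjacent_disagreement _ _ ors oss neq.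
have /andP[xyr _] := axy.
have cxy := eq_Inv_commuting _ _ _ _ eqI xyr xys.
pose t : AB n k :=
  exist (@admissible n k) _ (admissible_exchange _ _ _ (valP r) axy cxy).
have rt : sim r t.
  apply: connect1; apply/orP; left; apply/existsP; exists x.
  by apply/existsP; exists y; rewrite axy cxy /=.
suff: sim t s by apply: sim_trans.
apply: IHm; last by rewrite -(Inv_sim rt).
(* The pair [(y, x)] gained by [t] already belongs to [s], while the disagreement [(x, y)]
   disappears. *)
rewrite ltnS in le_m; apply: leq_trans le_m; apply/proper_card/properP; split.
- have /total_orderP[irr _ /(_ x y) tots] := oss.
  have neq_xy : x != y.
    apply: contraTneq xyr => ->.
    by have /total_orderP[irrr _ _] := ors; apply: irrr.
  have yxs : (y, x) \in val s by case: (tots neq_xy) => //; rewrite (negPf xys).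
  apply/subsetP => p; rewrite !inE => /andP[ps /orP[/eqP ep|/andP[_ ->]]].
    by rewrite ep yxs in ps.
  by rewrite ps.
- exists (x, y); first by rewrite inE xys.
  rewrite !inE eqxx /= orbF xys /= xpair_eqE; apply/negP => /andP[/eqP exy _].
  by have /total_orderP[irrr _ _] := ors; have := irrr x; rewrite {2}exy xyr.
Qed.

End InvInjective.

Theorem proposition7 (n k : nat) (hn : (1 <= n)%N) (hk : (1 <= k <= 3)%N) :
  injective (@InvB n k).
Proof.
(* [InvB] is computed on canonical representatives, so its equality on [c] and [d] makes their
   representatives equivalent. *)
move=> c d /eq_Inv_sim rcd.
rewrite -[c]generic_quotient.reprK -[d]generic_quotient.reprK.
exact/(generic_quotient.eqmodP (sim_equiv n k)).
Qed.
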